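(* Let $F:\mathsf{Comp}\to\mathsf{Comp}$ be a functional functor and $X$ a compact Hausdorff space. The following conditions are equivalent: (1) $X$ is $F$-Dugundji; (2) every embedding $X\subset Y$ into a compact Hausdorff space $Y$ admits an $F$-regular extension operator $u:C(X)\to C(Y)$; (3) for every embedding $X\subset Y$ into a compact Hausdorff space $Y$ there exists a continuous map $s:Y\to FX$ such that $s(x)=\delta_X(x)$ for all $x\in X\subset Y$; (4) for some embedding $X\subset K$ into a Tychonoff cube $K=[0,1]^\kappa$ there exists a continuous map $s:K\to FX$ such that $s(x)=\delta_X(x)$ for all $x\in X\subset K$.
   Context: $\mathsf{Comp}$ is the category of compact Hausdorff spaces and continuous maps. For a compact Hausdorff space $X$, $C(X)$ is the space of continuous real-valued functions on $X$ and $\mathbb R^{C(X)}$ is the space of all (arbitrary) functions $\mu:C(X)\to\mathbb R$ with the Tychonoff product topology. A continuous map $f:X\to Y$ induces $f^*:C(Y)\to C(X)$, $f^*(\varphi)=\varphi\circ f$, and $f^{**}:\mathbb R^{C(X)}\to\mathbb R^{C(Y)}$, $f^{**}(\mu)(\varphi)=\mu(\varphi\circ f)$; this makes $\mathbb R^{C(\cdot)}$ a covariant functor to Tychonoff spaces. For $x\in X$, $\delta_X(x)\in\mathbb R^{C(X)}$ is the functional $\varphi\mapsto\varphi(x)$. A functional functor is a functor $F:\mathsf{Comp}\to\mathsf{Comp}$ which is a subfunctor of $\mathbb R^{C(\cdot)}$ (so $FX\subset\mathbb R^{C(X)}$ is a compact subspace for each $X$, and $Ff=f^{**}|FX$ maps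 $FX$ into $FY$) and such that $\delta_X(x)\in FX$ for every compact $X$ and $x\in X$. An operator $u:C(X)\to C(Y)$ is any function (not necessarily linear or continuous). It is $F$-regular if for every $y\in Y$ the functional $\varphi\mapsto u(\varphi)(y)$ on $C(X)$ belongs to $FX$. For an injective map $f:X\to Y$ (in particular an embedding), an extension operator for $f$ is an operator $u:C(X)\to C(Y)$ with $f^*\circ u=\mathrm{id}_{C(X)}$. $X$ is $F$-Dugundji if there is a continuous injective map $f:X\to K$ into a Tychonoff cube $K=[0,1]^\kappa$ ($\kappa$ a cardinal) admitting an $F$-regular extension operator $u:C(X)\to C(K)$. *)

(* Defs.v *)
From HB Require Import structures.
From mathcomp Require Import all_boot all_order all_algebra.
From mathcomp Require Import all_classical all_reals all_analysis.
Import Order.TTheory GRing.Theory Num.Theory numFieldNormedType.Exports.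

Set Implicit Arguments.
Unset Strict Implicit.
Unset Printing Implicit Defensive.

Local Open Scope classical_set_scope.
Local Open Scope ring_scope.

Record compHausType := CompHaus {
  compHaus_sort :> topologicalType;
  compHaus_compact : compact [set: compHaus_sort];
  compHaus_hausdorff : hausdorff_space compHaus_sort }.

Definition Cont (R : realType) (X : topologicalType) : Type :=
  continuousType X R.

(* All functions C(X) -> R, not only the linear or continuous ones. *)
Definition functionals (R : realType) (X : topologicalType) : topologicalType :=
  {ptws Cont R X -> R}.

Definition pullback (R : realType) (X Y : topologicalType)
    (f : continuousType X Y) : Cont R Y -> Cont R X :=
  fun phi => (phi : continuousType Y R) \o f.

Definition functionals_map (R : realType) (X Y : topologicalType)
    (f : continuousType X Y) : functionals R X -> functionals R Y :=
  fun mu phi => mu (pullback f phi).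

Definition delta (R : realType) (X : topologicalType) (x : X) :
    functionals R X :=
  fun phi => (phi : continuousType X R) x.

Arguments delta R {X} x _.

(* A subfunctor of [functionals R] is determined by its values on objects: on
   morphisms it is the restriction of [functionals_map].  The set [F X], coerced
   to a type, carries the subspace topology. *)
Record functionalFunctor (R : realType) := FunctionalFunctor {
  ff_obj :> forall X : compHausType, set (functionals R X);
  ff_compact : forall X : compHausType, compact (@ff_obj X);
  ff_map : forall (X Y : compHausType) (f : continuousType X Y)
    (mu : functionals R X), @ff_obj X mu -> @ff_obj Y (functionals_map f mu);
  ff_delta : forall (X : compHausType) (x : X), @ff_obj X (delta R x) }.

Arguments ff_obj {R} F X _ : rename.

Definition regular_operator (R : realType) (F : functionalFunctor R)
    (X : compHausType) (Y : topologicalType) (u : Cont R X -> Cont R Y) : Prop :=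
  forall y : Y, F X (fun phi => (u phi : continuousType Y R) y).

Definition extension_operator (R : realType) (X Y : topologicalType)
    (f : continuousType X Y) (u : Cont R X -> Cont R Y) : Prop :=
  pullback f \o u = idfun.

(* Homeomorphism onto the image: [V `&` range f] is the general form of an open
   subset of the subspace [range f]. *)
Definition embedding (X Y : topologicalType) (f : continuousType X Y) : Prop :=
  injective f /\
  forall U : set X, open U -> exists2 V : set Y, open V & f @` U = V `&` range f.

(* The Tychonoff cube; the exponent is an arbitrary type instead of a
   cardinal number. *)
Definition cube (R : realType) (I : Type) : topologicalType :=
  {ptws I -> (`[0, 1]%classic : set R)}.

Definition Dugundji (R : realType) (F : functionalFunctor R)
    (X : compHausType) : Prop :=
  exists (I : Type) (f : continuousType X (cube R I)), injective f /\
    exists u : Cont R X -> Cont R (cube R I),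
      regular_operator F u /\ extension_operator f u.

(* Main.v *)
(* An operator u : C(X) -> C(Y) and a map s : Y -> FX are two curryings of the
   same function, u phi y = s y phi; continuity of every u phi is continuity of
   s into the pointwise topology, F-regularity says that s lands in FX, and the
   extension property says that s is delta on X.  A Tychonoff cube is an absolute
   extensor for compact Hausdorff spaces (Tietze in each coordinate), so an
   operator for X in a cube is transported to any Y containing X by composing
   with an extension Y -> cube of X -> cube. *)
Require Import Defs.
From HB Require Import structures.
From mathcomp Require Import all_boot all_order all_algebra.
From mathcomp Require Import all_classical all_reals all_analysis.
Import Order.TTheory GRing.Theory Num.Theory numFieldNormedType.Exports.

Set Implicit Arguments.
Unset Strict Implicit.
Unset Printing Implicit Defensive.

Local Open Scope classical_set_scope.
Local Open Scope ring_scope.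

(** * Pointwise topology and embeddings of compact spaces *)

Lemma ptws_continuous (I : Type) (T Y : topologicalType)
    (f : Y -> {ptws I -> T}) :
  (forall i, continuous (fun y => f y i)) -> continuous f.
Proof.
move=> fc y; apply/cvg_sup => i.
exact: (@continuous_comp_initial _ _ _ (fun g : I -> T => g i) f (fc i)).
Qed.

Lemma ptws_eval_continuous (I : Type) (T : topologicalType) (i : I) :
  continuous (fun g : {ptws I -> T} => g i).
(* [{classic I}] is [I] with its classical choice structure, so the index may be any type. *)
Proof. exact: (@proj_continuous {classic I} (fun=> T) i). Qed.

Lemma injective_hausdorff (X Y : topologicalType) (f : X -> Y) :
  continuous f -> injective f -> hausdorff_space Y -> hausdorff_space X.
Proof.
move=> fc fi hY p q pq; apply/fi/hY => A B /fc fA /fc fB.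
by have [x [Ax Bx]] := pq _ _ fA fB; exists (f x).
Qed.

Lemma compact_embedding (X Y : topologicalType) (f : continuousType X Y) :
  compact [set: X] -> hausdorff_space Y -> injective f -> embedding f.
Proof.
move=> cX hY fi; split=> // U oU; exists (~` (f @` (~` U))).
  apply: closed_openC; apply: compact_closed => //.
  apply: continuous_compact; first exact/continuous_subspaceT/cts_fun.
  by apply: (subclosed_compact _ cX) => //; exact: open_closedC.
apply/seteqP; split=> y /=.
  by move=> [x Ux <-]; split; [move=> [z nUz /fi zx]; apply: nUz; rewrite zx|exists x].
move=> [nUy [x _ xy]]; exists x => //; apply: contrapT => nUx.
by apply: nUy; exists x.
Qed.

(** * The unit interval and the Tychonoff cube *)

Notation unit_itv R := (`[0, 1]%classic : set R).

Section UnitInterval.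
Context (R : realType).

(** A continuous retraction of the line onto the unit interval; it turns real functions into maps to
    the subtype without changing values already in [0, 1]. *)
Definition clamp_val (r : R) : R := Num.min 1 `|r|.

Lemma clamp_val_itv r : clamp_val r \in unit_itv R.
Proof.
by apply/mem_set; rewrite /= in_itv /= /clamp_val le_min ler01 normr_ge0 ge_min lexx.
Qed.

Definition clamp r : unit_itv R := SigSub (clamp_val_itv r).

Lemma clamp_set_val (t : unit_itv R) : clamp (set_val t) = t.
Proof.
apply: val_inj => /=; have := set_mem (valP t); rewrite /= in_itv /= => /andP[t0 t1].
by rewrite /clamp_val ger0_norm // min_r.
Qed.

Lemma clamp_continuous : continuous clamp.
Proof.
apply: continuous_comp_initial => r /=.
by apply: (@continuous_min _ R (fun=> 1) (fun r => `|r|)); [exact: cvg_cst|exact: norm_continuous].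
Qed.

Lemma compact_unit_itv : compact [set: unit_itv R].
Proof.
(* Compactness of the segment, a subset of the line, passes to the subtype along the retraction. *)
have -> : [set: unit_itv R] = clamp @` unit_itv R.
  apply/seteqP; split=> // t _; exists (set_val t); last exact: clamp_set_val.
  exact: set_mem (valP t).
apply: continuous_compact; last exact: segment_compact.
exact/continuous_subspaceT/clamp_continuous.
Qed.

Lemma hausdorff_unit_itv : hausdorff_space (unit_itv R).
Proof.
apply: (injective_hausdorff (@initial_continuous _ _ (@set_val _ (unit_itv R)))).
  exact: val_inj.
exact: Rhausdorff.
Qed.

Lemma compact_cube (I : Type) : compact [set: cube R I].
Proof.
have := @tychonoff {classic I} _ _ (fun=> compact_unit_itv).
by congr compact; apply/seteqP; split.
Qed.

Lemma hausdorff_cube (I : Type) : hausdorff_space (cube R I).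
Proof. exact: (@hausdorff_product {classic I} _ (fun=> hausdorff_unit_itv)). Qed.

Definition cube_compHaus (I : Type) : compHausType :=
  CompHaus (@compact_cube I) (@hausdorff_cube I).

End UnitInterval.

(** * Separation, extension and embedding into cubes *)

Lemma compHaus_normal (X : compHausType) : normal_space X.
Proof. exact: compact_normal (@compHaus_hausdorff X) (@compHaus_compact X). Qed.

Lemma compHaus_closed1 (X : compHausType) (x : X) : closed [set x].
Proof. exact/accessible_closed_set1/hausdorff_accessible/compHaus_hausdorff. Qed.

(** For distinct points, a Urysohn function equal to 0 at [x] and 1 at [y] keeps these values after
    clamping. *)
Lemma compHaus_separated (R : realType) (X : compHausType) (x y : X) :
  (forall g : continuousType X (unit_itv R), g x = g y) -> x = y.
Proof.
move=> xy; apply: contrapT => nxy.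
have xy0 : [set x] `&` [set y] = set0.
  by apply/seteqP; split=> // z [/= -> /nxy].
have [g [gc g0 g1 _]] := urysohn_ext_itv (@compHaus_normal X)
  (@compHaus_closed1 X x) (@compHaus_closed1 X y) xy0 (@ltr01 R).
have cgc : continuous (@clamp R \o g).
  by move=> z; apply: continuous_comp; [exact: gc|exact: clamp_continuous].
have := congr1 val (xy (mkcts cgc)); rewrite /= /mkcts /= /clamp_val.
have -> : g x = 0 by apply: g0; exists x.
have -> : g y = 1 by apply: g1; exists y.
by rewrite normr0 normr1 minxx min_r // => /eqP; rewrite eq_sym oner_eq0.
Qed.

Lemma tietze_unit_itv (R : realType) (X Y : compHausType)
    (e : continuousType X Y) (f : continuousType X (unit_itv R)) :
  embedding e -> exists g : continuousType Y (unit_itv R), forall x, g (e x) = f x.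
Proof.
move=> [ei eo].
(* [h] is [f] transported along the inverse of [e]; the default 0 is taken only off [range e], where
   no continuity is claimed. *)
pose h (y : Y) : R := xget 0 [set r | exists2 x, e x = y & r = set_val (f x)].
have he x : h (e x) = set_val (f x).
  by apply: xget_unique; [exists x|move=> r [z /ei -> ->]].
have hc : {within range e, continuous h}.
  apply/continuousP => O oO; apply/open_subspaceP.
  have oU : open ((fun x => set_val (f x)) @^-1` O).
    apply: open_comp => // x _; apply: continuous_comp; first exact: cts_fun.
    exact: initial_continuous.
  (* On [range e], the preimage of [O] under [h] is the [e]-image of its preimage under [f],
     relatively open because [e] is an embedding. *)
  have [V oV Ve] := eo _ oU; exists V => //; rewrite -Ve; apply/seteqP; split=> y /=.
    by move=> [x fx <-]; split; [rewrite /from_subspace he|exists x].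
  by rewrite /from_subspace => -[hO [x _ xy]]; exists x => //; rewrite -he xy.
have h1 y : range e y -> `|h y| <= 1.
  move=> [x _ <-]; rewrite he.
  have := set_mem (valP (f x)); rewrite /= in_itv /= => /andP[f0 f1].
  by rewrite ger0_norm.
have cle : closed (range e).
  apply: compact_closed; first exact: compHaus_hausdorff.
  apply: continuous_compact; last exact: compHaus_compact.
  exact/continuous_subspaceT/cts_fun.
have [g [gh gc _]] := continuous_bounded_extension (@compHaus_normal Y) cle ltr01 hc h1.
(* The Tietze extension is only real-valued; clamping brings it into the interval and fixes its
   values on [range e]. *)
have cgc : continuous (@clamp R \o g).
  by move=> z; apply: continuous_comp; [exact: gc|exact: clamp_continuous].
exists (mkcts cgc) => x; rewrite /= /mkcts /= -gh ?he ?clamp_set_val //.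
by apply/mem_set; exists x.
Qed.

Lemma cube_absolute_extensor (R : realType) (X Y : compHausType) (I : Type)
    (e : continuousType X Y) (f : continuousType X (cube R I)) :
  embedding e -> exists g : continuousType Y (cube R I), forall x, g (e x) = f x.
Proof.
move=> ee.
have fic i : continuous (fun x => f x i).
  move=> x; apply: (@continuous_comp _ _ _ f (fun p : cube R I => p i)).
    exact: cts_fun.
  exact: ptws_eval_continuous.
have [g gf] := choice (fun i => tietze_unit_itv (mkcts (fic i)) ee).
have gc : continuous ((fun y i => g i y) : Y -> cube R I).
  by apply: ptws_continuous => i; exact: cts_fun.
by exists (mkcts gc) => x; apply/funext => i; exact: gf.
Qed.

(** The cube is indexed by all continuous maps from [X] to the interval, and [x] goes to evaluation
    at [x]; these maps separate points, and compactness does the rest. *)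
Lemma cube_embedding (R : realType) (X : compHausType) :
  exists (I : Type) (f : continuousType X (cube R I)), embedding f.
Proof.
have ec : continuous
    ((fun x g => g x) : X -> cube R (continuousType X (unit_itv R))).
  by apply: ptws_continuous => g; exact: cts_fun.
exists (continuousType X (unit_itv R)), (mkcts ec).
apply: compact_embedding; [exact: compHaus_compact|exact: hausdorff_cube|].
by move=> x y /(congr1 (fun p => p _)) xy; apply: (@compHaus_separated R) => g; exact: xy.
Qed.

(** * Extension operators and sections *)

Lemma Dugundji_extension (R : realType) (F : functionalFunctor R)
    (X Y : compHausType) (e : continuousType X Y) :
  Dugundji F X -> embedding e ->
  exists u : Cont R X -> Cont R Y, regular_operator F u /\ extension_operator e u.
Proof.
move=> [I [f [_ [u [ur ue]]]]] /(cube_absolute_extensor f)[g gf].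
(* The functional of the new operator at [y] is that of [u] at [g y]; on [X], [g \o e] is [f], which
   [u] extends along. *)
exists (pullback g \o u); split=> [y|]; first exact: ur.
apply/funext => phi; apply/continuousEP => x.
have uphi : pullback f (u phi) = phi := congr1 (fun v => v phi) ue.
by rewrite /= gf -[in RHS]uphi.
Qed.

Lemma regular_operator_section (R : realType) (F : functionalFunctor R)
    (X : compHausType) (Y : topologicalType) (f : continuousType X Y)
    (u : Cont R X -> Cont R Y) :
  regular_operator F u -> extension_operator f u ->
  exists s : continuousType Y (F X), forall x, set_val (s (f x)) = delta R x.
Proof.
move=> ur ue; pose s y : F X := SigSub (mem_set (ur y)).
have sc : continuous s.
  apply: continuous_comp_initial; apply: ptws_continuous => phi.
  exact: (@cts_fun _ _ (u phi)).
exists (mkcts sc) => x; apply/funext => phi.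
have uphi : pullback f (u phi) = phi := congr1 (fun v => v phi) ue.
by rewrite /delta -[in RHS]uphi.
Qed.

Lemma section_regular_operator (R : realType) (F : functionalFunctor R)
    (X : compHausType) (Y : topologicalType) (f : continuousType X Y)
    (s : continuousType Y (F X)) :
  (forall x, set_val (s (f x)) = delta R x) ->
  exists u : Cont R X -> Cont R Y, regular_operator F u /\ extension_operator f u.
Proof.
move=> sf.
have sc (phi : Cont R X) : continuous (fun y => (set_val (s y) : functionals R X) phi).
  move=> y.
  apply: (@continuous_comp _ _ _ (fun y => set_val (s y) : functionals R X)
    (fun mu : functionals R X => mu phi)).
    apply: (@continuous_comp _ _ _ s); first exact: cts_fun.
    exact: initial_continuous.
  exact: ptws_eval_continuous.
exists (fun phi => mkcts (sc phi)); split=> [y|]; first exact: set_mem (valP (s y)).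
by apply/funext => phi; apply/continuousEP => x; rewrite /= /mkcts sf.
Qed.

Theorem theorem2p5 (R : realType) (F : functionalFunctor R) (X : compHausType) :
  [<->
    Dugundji F X;
    forall (Y : compHausType) (f : continuousType X Y), embedding f ->
      exists u : Cont R X -> Cont R Y, regular_operator F u /\ extension_operator f u;
    forall (Y : compHausType) (f : continuousType X Y), embedding f ->
      exists s : continuousType Y (F X),
        forall x : X, set_val (s (f x)) = delta R x;
    exists (I : Type) (f : continuousType X (cube R I)), embedding f /\
      exists s : continuousType (cube R I) (F X),
        forall x : X, set_val (s (f x)) = delta R x].
Proof.
tfae.
- by move=> XF Y f; exact: Dugundji_extension.
- by move=> ext Y f /ext[u [ur ue]]; exact: regular_operator_section ur ue.
(* The cube is itself compact Hausdorff, so it can serve as [Y]. *)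
- move=> sec; have [I [f fe]] := cube_embedding R X.
  by exists I, f; split=> //; exact: (sec (cube_compHaus R I)).
- move=> [I [f [[fi _] [s sf]]]]; exists I, f; split=> //.
  exact: section_regular_operator sf.
Qed.
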